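(* Let $k\ge 1$ be an integer and let $0<\mu_1<\mu_2<\cdots<\mu_k$ be real numbers. For $i=2,\ldots,k+1$ and integers $n\ge i$ define $$\gamma_{i,n}:=\sum_{j=1}^{i-1}\frac{\mu_j^{n-2}}{\prod_{t=1,\,t\ne j}^{i-1}(\mu_j-\mu_t)},\qquad \Omega_i:=\sum_{n=i}^{\infty}\frac{\gamma_{i,n}}{n!},\qquad \rho_i:=\frac{1}{\Omega_i}\sum_{n=i}^{\infty}\frac{\gamma_{i,n}}{n!}\,|n\rangle\langle n| .$$ Then for every $i=2,\ldots,k+1$ the operator $\rho_i$ is positive semi-definite, and for every $i=1,\ldots,k$ $$e^{-\mu_i}\sum_{n=0}^{\infty}\frac{\mu_i^n}{n!}|n\rangle\langle n| = e^{-\mu_i}\Bigl(|0\rangle\langle 0|+\mu_i|1\rangle\langle 1|+\sum_{n=2}^{i+1}\mu_i^2\prod_{t=1}^{n-2}(\mu_i-\mu_t)\,\Omega_n\,\rho_n\Bigr).$$ Moreover, for every $i=1,\ldots,k$ and $n=2,\ldots,i+1$ the coefficient $\mu_i^2\prod_{t=1}^{n-2}(\mu_i-\mu_t)\,\Omega_n$ is positive.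
   Context: $\{|n\rangle\}_{n=0}^{\infty}$ denotes the orthonormal number-state (Fock) basis of a separable Hilbert space (e.g. $\ell^2(\mathbb{Z}_{\ge 0})$), and $|n\rangle\langle n|$ is the rank-one orthogonal projection onto $|n\rangle$. Empty products equal $1$ (so $\gamma_{2,n}=\mu_1^{n-2}$, and the $n=2$ coefficient is $\mu_i^2\Omega_2$). *)

(* Defs.v *)
From HB Require Import structures.
From mathcomp Require Import all_boot all_order all_algebra.
From mathcomp Require Import all_classical all_reals all_analysis.
From mathcomp Require Import complex.

Set Implicit Arguments.
Unset Strict Implicit.
Unset Printing Implicit Defensive.

Import Order.TTheory GRing.Theory Num.Def Num.Theory.
Import numFieldNormedType.Exports.

Local Open Scope ring_scope.
Local Open Scope complex_scope.
Local Open Scope classical_set_scope.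

(** A complex Hilbert space is a complete normed space [H] over [R[i]] with an
    inner product [dot : {dot H for conjC}] inducing its norm.  With the
    library's convention, [dot] is linear on the left and antilinear on the
    right, so that the bracket <u|v> of physics is [dot v u]. *)
Section Hilbert.
Context {R : realType} {H : completeNormedModType R[i]}.

Definition induces_norm (dot : {dot H for conjC}) : Prop :=
  forall u : H, `|u| ^+ 2 = dot u u.

Definition orthonormal_basis (dot : {dot H for conjC}) (e : nat -> H) : Prop :=
  (forall m n, dot (e m) (e n) = (m == n)%:R) /\
  (forall u : H, (fun N => \sum_(0 <= n < N) dot u (e n) *: e n) @ \oo --> u).

(** The rank-one operator |u><u|. *)
Definition ketbra (dot : {dot H for conjC}) (u : H) : H -> H :=
  fun psi => dot psi u *: u.

(** Operator series are summed in the strong operator topology.  As [limn] is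
    total, [opsum] is meaningful only under [opsum_cvg]. *)
Definition opsum_cvg (m : nat) (T : nat -> H -> H) : Prop :=
  forall psi : H, cvgn (fun N => \sum_(m <= n < N) T n psi).

Definition opsum (m : nat) (T : nat -> H -> H) : H -> H :=
  fun psi => limn (fun N => \sum_(m <= n < N) T n psi).

(** In the order of [R[i]], [0 <= z] means that [z] is real and nonnegative,
    so the last clause contains the self-adjointness of [T]. *)
Definition positive_semidefinite (dot : {dot H for conjC}) (T : H -> H) :
    Prop :=
  [/\ linear T, continuous T & forall psi : H, 0 <= dot (T psi) psi].

End Hilbert.

(** The sequence [mu] is indexed from 1; [mu 0] is never used.
    [gamma mu i n] is meant for [2 <= i <= n], [Omega mu i] for [2 <= i] and
    [coef mu i n] for [2 <= n <= i.+1]. *)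
Section Coefficients.
Context {R : realType}.
Implicit Types (mu : nat -> R) (i n : nat).

Definition gamma mu i n : R :=
  \sum_(1 <= j < i)
    mu j ^+ (n - 2) / \prod_(1 <= t < i | t != j) (mu j - mu t).

Definition Omega_partial mu i : nat -> R :=
  fun N => \sum_(i <= n < N) gamma mu i n / n`!%:R.

Definition Omega mu i : R := limn (Omega_partial mu i).

Definition coef mu i n : R :=
  mu i ^+ 2 * \prod_(1 <= t < n - 1) (mu i - mu t) * Omega mu n.

End Coefficients.

Section States.
Context {R : realType} {H : completeNormedModType R[i]}.
Variables (dot : {dot H for conjC}) (ket : nat -> H) (mu : nat -> R).

Definition rho_term (i n : nat) : H -> H :=
  (gamma mu i n / n`!%:R)%:C *: ketbra dot (ket n).

Definition rho (i : nat) : H -> H :=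
  ((Omega mu i)^-1)%:C *: opsum i (rho_term i).

Definition poisson_term (i n : nat) : H -> H :=
  (mu i ^+ n / n`!%:R)%:C *: ketbra dot (ket n).

End States.

(* Main.v *)
(** The number gamma_{i,n} is the divided difference of x^(n-2) at the nodes
    mu_1, ..., mu_{i-1}.  From the recursion
    gamma_{i+1,n+1} = mu_i gamma_{i+1,n} + gamma_{i,n} one reads off that it
    vanishes for n < i and is positive for n >= i, and Newton's interpolation
    formula evaluated at the node mu_i is the claimed identity, coefficient by
    coefficient: the interpolation polynomial of degree < i is exact there.
    Every operator involved is diagonal in the Fock basis with summable
    nonnegative eigenvalues, so its series converges strongly and defines a
    bounded positive operator. *)

Require Import Defs.
From HB Require Import structures.
From mathcomp Require Import all_boot all_order all_algebra.
From mathcomp Require Import all_classical all_reals all_analysis.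
From mathcomp Require Import complex ring lra zify.
Import Order.TTheory GRing.Theory Num.Def Num.Theory.
Import numFieldNormedType.Exports.
Local Open Scope ring_scope.
Local Open Scope complex_scope.

Set Implicit Arguments.
Unset Strict Implicit.
Unset Printing Implicit Defensive.

(** * Order and norm bounds under limits *)

Lemma ge0_of_approx (R : realType) (z : R[i]) :
  (forall e : R, 0 < e -> exists2 w : R[i], 0 <= w & `|z - w| < e%:C) ->
  0 <= z.
Proof.
move=> approx; rewrite lecE /=.
have Re_dist e (w : R[i]) : `|z - w| < e%:C ->
    `|complex.Re (z - w)| < e /\ `|complex.Im (z - w)| < e.
  move=> zw; split; rewrite -ltcR; apply: le_lt_trans zw.
    exact: normc_ge_Re.
  (* Up to sign, the imaginary part of [z - w] is the real part of its product with ['i], which has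
     the same modulus. *)
  have := normc_ge_Re ((z - w) * 'i%C).
  by rewrite ReiNIm normrN normrM [`|'i%C|]normc_def /= expr0n add0r expr1n
    sqrtr1 mulr1.
apply/andP; split.
  apply/eqP/normr0_eq0/eqP; rewrite eq_le normr_ge0 andbT.
  apply/ler_addgt0Pr => e e0; rewrite add0r.
  have [w w0 /Re_dist[_]] := approx e e0.
  by rewrite raddfB /= (ger0_Im w0) subr0 => /ltW.
rewrite leNgt; apply/negP => Rez.
have [w w0 /Re_dist[+ _]] := approx (- complex.Re z) ltac:(by rewrite oppr_gt0).
have Rew : 0 <= complex.Re w by move: w0; rewrite lecE => /andP[].
rewrite raddfB /= ltr_norml => /andP[] +; lra.
Qed.

Lemma norm_lim_le (K : numFieldType) (V : normedModType K) (u : nat -> V)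
    (l : V) (b : K) :
  (u @ \oo --> l)%classic -> (forall n, `|u n| <= b) -> `|l| <= b.
Proof.
(* The order of [K] may be partial; [b] is comparable with norms because, bounding one from above,
   it is real. *)
move=> ul ub; have b_real : b \is Num.real.
  exact: ger0_real (le_trans (normr_ge0 (u 0%N)) (ub 0%N)).
rewrite real_leNgt//; apply/negP => bl.
have lb : 0 < `|l| - b by rewrite subr_gt0.
have [N _ /(_ N (leqnn N)) /= lu] := (cvgrPdist_lt _ _).1 ul _ lb.
have := le_lt_trans (ler_normD (l - u N) (u N)) (ltr_leD lu (ub N)).
by rewrite !subrK ltxx.
Qed.

(** * Diagonal operators with summable nonnegative eigenvalues *)

Section DiagonalOperators.
Variables (R : realType) (H : completeNormedModType R[i]).
Variables (dot : {dot H for conjC}) (ket : nat -> H).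
Hypothesis dot_norm : induces_norm dot.
Hypothesis ket_unit : forall n, dot (ket n) (ket n) = 1.

Lemma dot_le (u v : H) : `|dot u v| <= `|u| * `|v|.
Proof.
have [->|v0] := eqVneq v 0; first by rewrite linear0r !normr0 mulr0.
rewrite -ler_sqr ?nnegrE ?mulr_ge0// exprMn !dot_norm.
have vv0 : 0 < dot v v by rewrite dnorm_gt0.
(* This vector is [dot v v] times the component of [u] orthogonal to [v]; its squared norm is
   [dot v v] times the defect in the Cauchy-Schwarz inequality. *)
have := dnorm_ge0 dot (dot v v *: u - dot u v *: v).
rewrite dnormB !dnormZ linearZl_LR linearZr_LR /=.
rewrite [conjC _ * _]mulrC -normCK.
rewrite (geC0_conj (mulr_ge0 (ltW vv0) (exprn_ge0 2 (normr_ge0 (dot u v))))).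
rewrite (ger0_norm (ltW vv0)).
rewrite (_ : _ - _ = dot v v * (dot u u * dot v v - `|dot u v| ^+ 2)).
  by rewrite pmulr_rge0// subr_ge0.
by ring.
Qed.

Let norm_ket n : `|ket n| = 1.
Proof.
by apply/eqP; rewrite -(eqrXn2 (n := 2)) ?normr_ge0// dot_norm ket_unit expr1n.
Qed.

Let ketbra_le n (psi : H) : `|ketbra dot (ket n) psi| <= `|psi|.
Proof.
rewrite /ketbra normrZ norm_ket mulr1.
by apply: le_trans (dot_le _ _) _; rewrite norm_ket mulr1.
Qed.

Let ketbra_linear n : linear (ketbra dot (ket n)).
Proof.
by move=> a u v; rewrite /ketbra linearDl/= linearZl_LR/= scalerDl scalerA.
Qed.

Variable c : nat -> R.
Hypothesis c_ge0 : forall n, 0 <= c n.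

Let term n : H -> H := (c n)%:C *: ketbra dot (ket n).

Let termE n psi : term n psi = (c n)%:C *: ketbra dot (ket n) psi.
Proof. by []. Qed.

Let term_sum_le (a b : nat) (psi : H) :
  `|\sum_(a <= n < b) term n psi| <= (\sum_(a <= n < b) c n)%:C * `|psi|.
Proof.
rewrite rmorph_sum mulr_suml; apply: le_trans (ler_norm_sum _ _ _) _.
apply: ler_sum => n _.
rewrite termE normrZ ger0_norm ?ler0c//.
by rewrite ler_wpM2l ?ler0c.
Qed.

Variable m : nat.
Hypothesis c_cvg : cvgn (fun N => \sum_(m <= n < N) c n).

(** A block of terms at [psi] has norm at most the same block of [c] times the norm of [psi], so the
    Cauchy criterion passes from the scalars to the complete space [H]. *)
Lemma diagonal_cvg : opsum_cvg m term.
Proof.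
move=> psi; rewrite is_cvg_series_restrict.
apply/cauchy_cvgP/cauchy_seriesP => e e0.
pose p := complex.Re `|psi|.
have psiE : `|psi| = p%:C by rewrite RRe_real ?normr_real.
have p0 : 0 <= p by rewrite -ler0c -psiE.
have eE : e = (complex.Re e)%:C by rewrite RRe_real ?gtr0_real.
(* [p + 1] keeps the denominator positive when [psi] is zero. *)
have d0 : 0 < complex.Re e / (p + 1).
  by rewrite divr_gt0 ?ltr_wpDl// -ltcR -eE.
move: c_cvg; rewrite is_cvg_series_restrict => /cauchy_cvgP/cauchy_seriesP.
move=> /(_ _ d0); apply: filterS => -[a b] /= cab.
apply: le_lt_trans (term_sum_le a b psi) _.
rewrite psiE eE -rmorphM ltcR.
have : complex.Re e = complex.Re e / (p + 1) * (p + 1).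
  by rewrite divfK// gt_eqF// ltr_wpDl.
move: cab; rewrite ger0_norm ?sumr_ge0//; nra.
Qed.

Let term_lim psi :
  ((fun N => \sum_(m <= n < N) term n psi) @ \oo --> opsum m term psi)%classic.
Proof. exact: diagonal_cvg. Qed.

(** Linearity, the bound by the sum of [c] and positivity hold for partial sums and survive the
    strong limit. *)
Lemma diagonal_positive_semidefinite :
  positive_semidefinite dot (opsum m term).
Proof.
have T_linear : linear (opsum m term).
  move=> a u v; apply/cvg_lim; first exact: norm_hausdorff.
  rewrite (_ : (fun N => _) = (fun N => a *: \sum_(m <= n < N) term n u +
     \sum_(m <= n < N) term n v)).
    by apply: cvgD; [apply: cvgZr|]; exact: term_lim.
  apply/funext => N; rewrite scaler_sumr -big_split; apply: eq_bigr => n _ /=.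
  rewrite !termE ketbra_linear scalerDr; congr (_ + _).
  by rewrite scalerA [RHS]scalerA mulrC.
have T_le psi :
    `|opsum m term psi| <= (limn (fun N => \sum_(m <= n < N) c n))%:C * `|psi|.
  apply: (norm_lim_le (@term_lim psi)) => N.
  apply: le_trans (term_sum_le _ _ _) _; rewrite ler_wpM2r// lecR.
  apply: nondecreasing_cvgn_le => //.
  by apply: nondecreasing_series.
split=> //.
  pose T : {linear H -> H} :=
    HB.pack (opsum m term)
      (GRing.isLinear.Build _ _ _ _ (opsum m term) T_linear).
  apply: (bounded_linear_continuous (f := T)).
  apply/linear_boundedP; near=> r => psi.
  apply: le_trans (T_le psi) _; rewrite ler_wpM2r//; near: r.
  by apply: nbhs_pinfty_ge; rewrite complex_real.
move=> psi; apply: ge0_of_approx => e e0.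
have d0 : 0 < e%:C / (`|psi| + 1) by rewrite divr_gt0 ?ltr_wpDl// ltcR.
have [N _ /(_ N (leqnn N)) /= TN] := (cvgrPdist_lt _ _).1 (@term_lim psi) _ d0.
exists (dot (\sum_(m <= n < N) term n psi) psi).
  (* Each term contributes [c n] times the squared modulus of [dot psi (ket n)]. *)
  rewrite linear_sumlz /=; apply: sumr_ge0 => n _.
  rewrite termE !linearZl_LR /=.
  rewrite [dot (ket n) psi]hermC expr0 mul1r -normCK.
  by rewrite mulr_ge0 ?exprn_ge0// ler0c.
rewrite -linearBl; apply: le_lt_trans (dot_le _ _) _.
apply: le_lt_trans (ler_wpM2r (normr_ge0 psi) (ltW TN)) _.
rewrite mulrAC ltr_pdivrMr ?ltr_wpDl// ltr_pM2l ?ltcR//.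
by rewrite ltrDl ltr01.
Unshelve. all: by end_near. Qed.

End DiagonalOperators.

(** * Divided differences of monomials *)

Section DividedDifferences.
Variables (F : fieldType) (x : nat -> F).
Implicit Types (r : seq nat) (p : nat).

(** Lagrange form; nodes are listed by index so that they can be permuted and peeled off. *)
Definition divdiff r p : F :=
  \sum_(j <- r) x j ^+ p / \prod_(t <- r | t != j) (x j - x t).

Lemma perm_divdiff r r' p : perm_eq r r' -> divdiff r p = divdiff r' p.
Proof.
move=> rr'; rewrite /divdiff (perm_big _ rr') /=; apply: eq_bigr => j _.
by rewrite (perm_big _ rr').
Qed.

(** Split x_j^(p+1) as x_b x_j^p + (x_j - x_b) x_j^p: the last factor cancels the one that [b] puts
    into the denominator. *)
Lemma divdiff_cons b r p : (forall j, j \in r -> x j != x b) ->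
  divdiff (b :: r) p.+1 = x b * divdiff (b :: r) p + divdiff r p.
Proof.
move=> xb; rewrite /divdiff !big_cons mulrDr mulrA -exprS -addrA.
congr (_ + _).
rewrite mulr_sumr -big_split; apply: eq_big_seq => j jr /=.
have bj : b != j by apply: contraNneq (xb j jr) => ->.
rewrite big_cons bj exprS.
have := xb j jr; rewrite -subr_eq0 => xbj.
rewrite invfM; set P := (\prod_(_ <- _ | _) _)^-1.
by field.
Qed.

(** Compare the two expansions of the power [p.+1] obtained by peeling off [a] and by peeling off
    [b]. *)
Lemma divdiff_exchange a b r p :
  x a != x b -> (forall j, j \in r -> x j != x a) ->
  (forall j, j \in r -> x j != x b) ->
  (x a - x b) * divdiff [:: a, b & r] p =
  divdiff (a :: r) p - divdiff (b :: r) p.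
Proof.
move=> xab xa xb.
have ba : perm_eq [:: a, b & r] [:: b, a & r].
  by rewrite -[[:: a, b & r]]/([:: a] ++ [:: b] ++ r) perm_catCA.
have := perm_divdiff p.+1 ba.
rewrite !divdiff_cons -?(perm_divdiff _ ba); first last.
- by move=> j; rewrite inE => /predU1P[->|/xa//]; rewrite eq_sym.
- by move=> j; rewrite inE => /predU1P[->|/xb].
move=> /eqP; rewrite -subr_eq0 => /eqP E.
by apply/eqP; rewrite -subr_eq0; apply/eqP; rewrite -E; ring.
Qed.

(** Induction on the number of nodes: the exchange formula subtracts 1 from 1 at two nodes, and 0
    from 0 afterwards. *)
Lemma divdiff_expr0 a b r : uniq (map x [:: a, b & r]) ->
  divdiff [:: a, b & r] 0 = 0.
Proof.
have neq_mem d s : x d \notin map x s -> forall j, j \in s -> x j != x d.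
  by move=> ds j js; apply: contraNneq ds => <-; apply: map_f.
elim: r a b => [|c r IHr] a b.
  rewrite /= !inE andbT => xab.
  apply: (mulfI (x := x a - x b)); first by rewrite subr_eq0.
  rewrite divdiff_exchange// /divdiff !big_cons !big_nil !eqxx.
  by rewrite !expr0 subrr mulr0.
rewrite [uniq _]/= inE negb_or -!andbA => /and5P[xab xacr xbcr xcr r_uniq].
apply: (mulfI (x := x a - x b)); first by rewrite subr_eq0.
rewrite divdiff_exchange//; [|exact: neq_mem..].
by rewrite !IHr ?subrr ?mulr0//= ?xacr ?xbcr xcr.
Qed.

End DividedDifferences.

(** * Signs of gamma, Newton interpolation and convergence of Omega *)

Section Gamma.
Variables (R : realType) (k : nat) (mu : nat -> R).
Hypothesis mu1_gt0 : 0 < mu 1%N.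
Hypothesis mu_incr : forall i : nat, (1 <= i < k)%N -> mu i < mu i.+1.

Lemma mu_lt i j : (1 <= i)%N -> (i < j <= k)%N -> mu i < mu j.
Proof.
move=> i1; elim: j => // j IHj /andP[].
rewrite ltnS leq_eqVlt => /predU1P[<-|ij] jk.
  by rewrite mu_incr// i1.
apply: lt_trans (IHj _) (mu_incr _); rewrite ?ij ?(ltnW jk)// jk andbT.
exact: leq_ltn_trans ij.
Qed.

Lemma mu_gt0 i : (1 <= i <= k)%N -> 0 < mu i.
Proof.
case: i => [|[|i]]// ik; apply: lt_trans mu1_gt0 _; exact: mu_lt.
Qed.

Lemma gammaE i n : gamma mu i n = divdiff mu (index_iota 1 i) (n - 2).
Proof. by []. Qed.

Let mu_uniq i : (i <= k.+1)%N -> uniq (map mu (index_iota 1 i)).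
Proof.
move=> ik; rewrite map_inj_in_uniq ?iota_uniq// => a b.
rewrite !mem_index_iota => /andP[a1 ai] /andP[b1 bi] ab.
have [lt_ab|lt_ba|//] := ltngtP a b.
  have : (a < b <= k)%N by rewrite lt_ab -ltnS (leq_trans bi).
  by move/(mu_lt a1); rewrite ab ltxx.
have : (b < a <= k)%N by rewrite lt_ba -ltnS (leq_trans ai).
by move/(mu_lt b1); rewrite ab ltxx.
Qed.

(** The node [mu i] is peeled off by [divdiff_cons]; the offset 2 keeps the truncated n - 2
    exact. *)
Lemma gamma_rec i p : (1 <= i <= k)%N ->
  gamma mu i.+1 p.+3 = mu i * gamma mu i.+1 p.+2 + gamma mu i p.+2.
Proof.
move=> /andP[i1 ik]; rewrite !gammaE subSn// subn2 /=.
have iE : perm_eq (index_iota 1 i.+1) (i :: index_iota 1 i).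
  rewrite /index_iota subSn// -[(i - 1).+1]addn1 iotaD cats1 subnKC//.
  by rewrite perm_rcons.
rewrite !(perm_divdiff _ _ iE) divdiff_cons// => j.
rewrite mem_index_iota => /andP[j1 ji].
by rewrite lt_eqF// mu_lt// ji.
Qed.

Lemma gamma1 n : gamma mu 1 n = 0.
Proof. by rewrite /gamma big_geq. Qed.

Lemma gamma22 : gamma mu 2 2 = 1.
Proof.
rewrite /gamma big_nat1 big1_seq ?divr1// => -[|[|t]]; rewrite mem_index_iota//.
Qed.

(** At n = 2 this is the divided difference of a constant; afterwards both terms of the recursion
    stay in the range n < i. *)
Lemma gamma_eq0 i n : (i <= k.+1)%N -> (2 <= n < i)%N -> gamma mu i n = 0.
Proof.
case: n => [|[|p]]//; elim: p i => [|p IHp] i ik /andP[_ pi].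
  rewrite gammaE subnn; have := mu_uniq ik.
  case: i ik pi => [|[|[|i]]]// ik _; exact: divdiff_expr0.
case: i ik pi => // i ik pi; rewrite gamma_rec; last by lia.
by rewrite !IHp ?mulr0 ?addr0//; lia.
Qed.

Lemma gamma_gt0 i n : (2 <= i <= k.+1)%N -> (i <= n)%N -> 0 < gamma mu i n.
Proof.
case: n => [|[|p]]; [by case: i => [|[]]|by case: i => [|[]]|].
elim: p i => [|p IHp] [|[|[|i]]]//= ik ip; first by rewrite gamma22 ltr01.
  rewrite gamma_rec// gamma1 addr0 mulr_gt0 ?mu_gt0//; exact: IHp.
rewrite gamma_rec// ltr_wpDl//; last by rewrite IHp// (ltnW ik).
(* On the diagonal n = i the first term of the recursion vanishes; beyond it, it is positive. *)
have [lt_pi|le_ip] := ltnP p.+2 i.+3; first by rewrite gamma_eq0 ?mulr0.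
by rewrite ltW// mulr_gt0 ?mu_gt0//; apply: IHp.
Qed.

Lemma gamma_ge0 i n : (2 <= i <= k.+1)%N -> 0 <= gamma mu i n.
Proof.
move=> ik; have ge2 p : 0 <= gamma mu i p.+2.
  have [pi|ip] := ltnP p.+2 i; last by rewrite ltW// gamma_gt0.
  by rewrite gamma_eq0//; case/andP: ik.
(* n - 2 truncates, so the values at n = 0 and n = 1 are the value at n = 2. *)
case: n => [|[|p]]; [exact: (ge2 0%N)|exact: (ge2 0%N)|exact: ge2].
Qed.

(** The Newton basis polynomial of degree m - 2, evaluated at [mu i]. *)
Let newton i m := \prod_(1 <= t < m - 1) (mu i - mu t).

(** Induction on [p]: multiplication by [mu i] sends N_m to N_(m+1) + mu_(m-1) N_m, which matches
    the recursion of gamma after a shift of index. *)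
Lemma newton_expansion i p : (1 <= i <= k)%N ->
  mu i ^+ p = \sum_(2 <= m < i.+2) newton i m * gamma mu m p.+2.
Proof.
move=> /andP[i1 ik]; elim: p => [|p IHp].
  rewrite big_ltn// gamma22 /newton big_geq// mul1r big_nat big1 ?addr0// => m.
  move=> /andP[m3 mi]; rewrite gamma_eq0 ?mulr0 ?m3//.
  by lia.
transitivity (\sum_(2 <= m < i.+2)
   (newton i m.+1 * gamma mu m p.+2 +
    newton i m * (mu m.-1 * gamma mu m p.+2))).
  rewrite exprS IHp mulr_sumr; apply: eq_big_nat => -[|[|m]]// _.
  rewrite /newton !subSS !subn0 [\prod_(1 <= t < m.+2) _]big_nat_recr//=.
  by ring.
have -> : \sum_(2 <= m < i.+2) newton i m * gamma mu m p.+3 =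
    \sum_(2 <= m < i.+2) newton i m * (mu m.-1 * gamma mu m p.+2) +
    \sum_(2 <= m < i.+2) newton i m * gamma mu m.-1 p.+2.
  rewrite -big_split; apply: eq_big_nat => -[|[|m]]//= mi.
  by rewrite gamma_rec ?mulrDr//; lia.
rewrite big_split addrC; congr (_ + _).
rewrite [LHS]big_nat_recr//= [RHS]big_ltn//= gamma1 mulr0 add0r.
(* The expansion stops here: this product contains the factor t = i. *)
rewrite [newton i i.+2](_ : _ = 0).
  by rewrite mul0r addr0 [RHS]big_add1.
by rewrite /newton subSS subn0 big_nat_recr//= subrr mulr0.
Qed.

Lemma newton_gt0 i m : (1 <= i <= k)%N -> (2 <= m <= i.+1)%N -> 0 < newton i m.
Proof.
move=> /andP[i1 ik] /andP[m2 mi]; rewrite /newton big_nat.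
apply: prodr_gt0 => t /andP[t1 tm]; rewrite subr_gt0 mu_lt// ik andbT.
by lia.
Qed.

(** Gamma_(i+1,n) is the top coefficient in the expansion of mu_i^(n-2), so an exponential series
    dominates. *)
Lemma Omega_partial_cvg i : (2 <= i <= k.+1)%N -> cvgn (Omega_partial mu i).
Proof.
case: i => [|i]//; rewrite ltnS => ik.
have newton_i := @newton_gt0 i i.+1 ik; rewrite leqnn andbT in newton_i.
have {}newton_i : 0 < newton i i.+1 by apply: newton_i; case/andP: ik.
have mu_i := mu_gt0 ik.
have gamma_le n : gamma mu i.+1 n / n`!%:R <=
    (newton i i.+1)^-1 * exp_coeff (1 + mu i) n.
  rewrite /exp_coeff /= mulrA ler_wpM2r ?invr_ge0// ler_pdivlMl//.
  (* all terms of the Newton expansion of mu_i^(n-2) are nonnegative *)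
  apply: (@le_trans _ _ (mu i ^+ (n - 2))).
    rewrite (newton_expansion _ ik) big_nat_recr//=; last by case/andP: ik.
    rewrite [gamma mu _ n](_ : _ = gamma mu i.+1 (n - 2).+2); last first.
      by rewrite !gammaE subSS subSS subn0.
    rewrite lerDr big_nat sumr_ge0// => m mi.
    by rewrite mulr_ge0 ?(ltW (newton_gt0 _ _)) ?gamma_ge0//; lia.
  (* A base at least 1 allows the exponent n - 2, truncated or not, to be raised to n. *)
  apply: (@le_trans _ _ ((1 + mu i) ^+ (n - 2))).
    by rewrite lerXn2r ?nnegrE ?addr_ge0 ?(ltW mu_i)// lerDr.
  by rewrite ler_weXn2l ?leq_subr// lerDl ltW.
rewrite is_cvg_series_restrict.
apply: series_le_cvg gamma_le _.
- by move=> n; rewrite divr_ge0// gamma_ge0// ltnS.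
- move=> n; rewrite mulr_ge0 ?invr_ge0 ?(ltW newton_i)// /exp_coeff /=.
  by rewrite divr_ge0// exprn_ge0// addr_ge0// ltW.
apply: is_cvg_seriesZ; exact: is_cvg_series_exp_coeff.
Qed.

Lemma Omega_gt0 i : (2 <= i <= k.+1)%N -> 0 < Omega mu i.
Proof.
move=> ik; apply: (@lt_le_trans _ _ (Omega_partial mu i i.+1)).
  by rewrite /Omega_partial big_nat1 divr_gt0 ?gamma_gt0// ltr0n fact_gt0.
apply: nondecreasing_cvgn_le; last exact: Omega_partial_cvg.
by apply: nondecreasing_series => n _ _; rewrite divr_ge0 ?gamma_ge0.
Qed.

Lemma coef_gt0 i n : (1 <= i <= k)%N -> (2 <= n <= i.+1)%N -> 0 < coef mu i n.
Proof.
move=> ik ni; rewrite /coef !mulr_gt0 ?exprn_gt0 ?mu_gt0 ?newton_gt0//.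
rewrite Omega_gt0//; move: ik ni; lia.
Qed.

End Gamma.

(** * Decomposition of the Poisson mixture *)

Lemma positive_semidefiniteZ (R : realType) (H : completeNormedModType R[i])
    (dot : {dot H for conjC}) (a : R) (T : H -> H) :
  0 <= a -> positive_semidefinite dot T ->
  positive_semidefinite dot (a%:C *: T).
Proof.
move=> a0 [T_linear T_cont T_ge0].
have aTE psi : (a%:C *: T) psi = a%:C *: T psi by [].
split=> [b u v|u|psi].
- by rewrite !aTE T_linear scalerDr !scalerA mulrC.
- exact: cvgZr (T_cont u).
- by rewrite aTE linearZl_LR mulr_ge0 ?ler0c ?T_ge0.
Qed.

(** At a fixed vector both sides have equal partial sums from N = 2 on, and a finite sum of
    convergent series may be taken to the limit. *)
Lemma poisson_decomposition (R : realType) (H : completeNormedModType R[i])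
    (dot : {dot H for conjC}) (ket : nat -> H) (k : nat) (mu : nat -> R)
    (i : nat) (mu1_gt0 : 0 < mu 1%N)
    (mu_incr : forall i : nat, (1 <= i < k)%N -> mu i < mu i.+1)
    (rho_cvg : forall m, (2 <= m <= k.+1)%N ->
      opsum_cvg m (rho_term dot ket mu m)) :
  (1 <= i <= k)%N ->
  opsum 0 (poisson_term dot ket mu i) =
  ketbra dot (ket 0%N) + (mu i)%:C *: ketbra dot (ket 1%N)
    + \sum_(2 <= n < i.+2) (coef mu i n)%:C *: rho dot ket mu n.
Proof.
move=> ik; apply/funext => psi; apply/cvg_lim; first exact: norm_hausdorff.
(* [coef] without its factor [Omega], which cancels the normalisation of [rho]. *)
pose a m := mu i ^+ 2 * \prod_(1 <= t < m - 1) (mu i - mu t).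
have m_range m : (2 <= m < i.+2)%N -> (2 <= m <= k.+1)%N by move: ik; lia.
have -> : (ketbra dot (ket 0%N) + (mu i)%:C *: ketbra dot (ket 1%N)
    + \sum_(2 <= n < i.+2) (coef mu i n)%:C *: rho dot ket mu n) psi =
  ketbra dot (ket 0%N) psi + (mu i)%:C *: ketbra dot (ket 1%N) psi +
  \sum_(2 <= m < i.+2) (a m)%:C *: opsum m (rho_term dot ket mu m) psi.
  rewrite [LHS]/(_ + _) fct_sumE; congr (_ + _).
  apply: eq_big_nat => m /m_range mi.
  transitivity ((coef mu i m)%:C *:
    ((Omega mu m)^-1%:C *: opsum m (rho_term dot ket mu m) psi)) => //.
  rewrite scalerA -rmorphM /coef mulfK//.
  by rewrite gt_eqF// (Omega_gt0 mu1_gt0 mu_incr mi).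
apply: (@cvg_trans _ ((fun N =>
    ketbra dot (ket 0%N) psi + (mu i)%:C *: ketbra dot (ket 1%N) psi +
    \sum_(2 <= m < i.+2)
      (a m)%:C *: \sum_(m <= n < N) rho_term dot ket mu m n psi)
    @ \oo)%classic).
  apply: near_eq_cvg; near=> N.
  have N2 : (2 <= N)%N by near: N; exists 2%N.
  rewrite [RHS]big_ltn ?(ltn_trans _ N2)// [in RHS]big_ltn// [RHS]addrA /=.
  congr (_ + _ + _).
  - by rewrite /poisson_term expr0 divr1 [RHS]scale1r.
  - by rewrite /poisson_term expr1 divr1.
  (* All inner sums are made to start at 2, so that the order of summation can be exchanged. *)
  under eq_big_nat => m mi.
    rewrite (big_nat_widenl m 2) ?(andP mi).1// big_mkcond scaler_sumr.
    over.
  rewrite exchange_big; apply: eq_big_nat => -[|[|p]]// _ /=.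
 transitivity ((\sum_(2 <= m < i.+2) a m * (gamma mu m p.+2 / p.+2`!%:R))%:C *:
      ketbra dot (ket p.+2) psi).
    rewrite rmorph_sum scaler_suml; apply: eq_big_nat => m mi /=.
    rewrite [in RHS]rmorphM -[RHS]scalerA; case: ifPn => [//|mp].
    rewrite (gamma_eq0 mu1_gt0 mu_incr) ?mul0r ?scale0r//; lia.
  congr (_%:C *: _).
  under eq_bigr do rewrite mulrA /a -[in X in X / _]mulrA.
  rewrite -mulr_suml -mulr_sumr -(newton_expansion mu1_gt0 mu_incr)//.
  by rewrite -exprD add2n.
apply: cvgD; first exact: cvg_cst.
rewrite big_nat; under eq_fun do rewrite big_nat.
apply: cvg_big => [|m /m_range mi]; first exact: add_continuous.
by apply: cvgZr; exact: rho_cvg.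
Unshelve. all: by end_near. Qed.

Theorem theorem1 (R : realType) (H : completeNormedModType R[i])
    (dot : {dot H for conjC}) (ket : nat -> H)
    (dot_norm : induces_norm dot) (ket_basis : orthonormal_basis dot ket)
    (k : nat) (mu : nat -> R)
    (k_ge1 : (1 <= k)%N)
    (mu1_gt0 : 0 < mu 1%N)
    (mu_incr : forall i : nat, (1 <= i < k)%N -> mu i < mu i.+1) :
  [/\ (* the series in the definitions of Omega_i, rho_i and of the left-hand
         side below converge *)
      (forall i : nat, (2 <= i <= k.+1)%N ->
        cvgn (Omega_partial mu i) /\ opsum_cvg i (rho_term dot ket mu i))
      /\ (forall i : nat, (1 <= i <= k)%N ->
        opsum_cvg 0 (poisson_term dot ket mu i)),
      (forall i : nat, (2 <= i <= k.+1)%N ->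
        positive_semidefinite dot (rho dot ket mu i)),
      (forall i : nat, (1 <= i <= k)%N ->
        (expR (- mu i))%:C *: opsum 0 (poisson_term dot ket mu i) =
        (expR (- mu i))%:C *:
          (ketbra dot (ket 0%N) + (mu i)%:C *: ketbra dot (ket 1%N)
           + \sum_(2 <= n < i.+2) (coef mu i n)%:C *: rho dot ket mu n))
    & (forall i n : nat, (1 <= i <= k)%N -> (2 <= n <= i.+1)%N ->
        0 < coef mu i n)].
Proof.
have ket_unit n : dot (ket n) (ket n) = 1 by rewrite ket_basis.1 eqxx.
have rho_cvg m : (2 <= m <= k.+1)%N -> opsum_cvg m (rho_term dot ket mu m).
  move=> mk; apply: diagonal_cvg (Omega_partial_cvg mu1_gt0 mu_incr mk) => // n.
  by rewrite divr_ge0 ?(gamma_ge0 mu1_gt0 mu_incr).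
split.
- split=> i ik.
    by split; [exact: (Omega_partial_cvg mu1_gt0 mu_incr)|exact: rho_cvg].
  apply: diagonal_cvg => // [n|].
    by rewrite divr_ge0 ?exprn_ge0// ltW// (mu_gt0 mu1_gt0 mu_incr).
  exact: is_cvg_series_exp_coeff.
- move=> i ik.
  apply: positive_semidefiniteZ.
    by rewrite invr_ge0 ltW// (Omega_gt0 mu1_gt0 mu_incr).
  apply: diagonal_positive_semidefinite => // [n|].
    by rewrite divr_ge0 ?(gamma_ge0 mu1_gt0 mu_incr).
  exact: (Omega_partial_cvg mu1_gt0 mu_incr).
- by move=> i ik; rewrite (poisson_decomposition mu1_gt0 mu_incr).
- exact: coef_gt0.
Qed.
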